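(* Let $k>1$ and let $x,w,v,u,X,W,V,U\in\mathbb N$ with $X<k^x$, $W<k^w$, $V<k^v$, $U<k^u$. For the elements $R^\ddagger_{k^x,X}R_{k^w,W}$ and $R^\ddagger_{k^v,V}R_{k^u,U}$ of $\mathcal A$: (1) if $(v,V)$ is a $k$-residue of $(w,W)$, then $$\left(R^\ddagger_{k^x,X}R_{k^w,W}\right)\left(R^\ddagger_{k^v,V}R_{k^u,U}\right)=R^\ddagger_{k^x,X}R_{k^s,S},\quad\text{where }(s,S)=\left((w,W)\backslash(v,V)\right)\cdot(u,U);$$ (2) if $(w,W)$ is a $k$-residue of $(v,V)$, then $$\left(R^\ddagger_{k^x,X}R_{k^w,W}\right)\left(R^\ddagger_{k^v,V}R_{k^u,U}\right)=R^\ddagger_{k^t,T}R_{k^u,U},\quad\text{where }(t,T)=\left((v,V)\backslash(w,W)\right)\cdot(x,X);$$ (3) if neither holds, the composite is $\epsilon$.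
   Context: $\mathbb N=\{0,1,2,\dots\}$. $\mathcal I(\mathbb N)$ is the symmetric inverse monoid on $\mathbb N$: all partial injections $\mathbb N\to\mathbb N$ under composition of partial functions ($fg$ means first $g$, then $f$), with generalised inverse $f^\ddagger(y)=x$ iff $f(x)=y$; its zero $\epsilon$ is the nowhere-defined partial function. For $a>b\in\mathbb N$, $R_{a,b}\in\mathcal I(\mathbb N)$ has domain $\{an+b:n\in\mathbb N\}$ and $R_{a,b}(n)=\frac{n-b}{a}$. $\mathcal A$ is the inverse subsemigroup of $\mathcal I(\mathbb N)$ generated by all $R_{a,b}$. For pairs of naturals $(m,n)$ with $n<k^m$, define $(d,c)\cdot(b,a)=(d+b,k^bc+a)$. Call $(y,x)$ a $k$-residue of $(b,a)$ when $y\le b$ and $a\bmod k^y=x$; in that case $(b,a)\backslash(y,x)=\left(b-y,\frac{a-x}{k^y}\right)$ if $b>y$, and $(0,0)$ (the identity for $\cdot$) if $b=y$. *)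

(* Defs.v *)
From mathcomp Require Import all_boot.
From Stdlib Require Import FunctionalExtensionality PropExtensionality.
From Stdlib Require Import ProofIrrelevance.
Set Implicit Arguments.
Unset Strict Implicit.
Unset Printing Implicit Defensive.

Declare Scope pinj_scope.
Delimit Scope pinj_scope with pinj.
Local Open Scope nat_scope.

(* A partial injection is represented by its graph: [f n m] means that [f] is
   defined at [n] with value [m]. *)
Record pinj := PInj {
  graph :> nat -> nat -> Prop;
  graph_functional : forall n m m', graph n m -> graph n m' -> m = m';
  graph_injective : forall n n' m, graph n m -> graph n' m -> n = n'
}.

Bind Scope pinj_scope with pinj.

(* Hence [=] on [pinj] is equality of partial functions. *)
Lemma pinj_ext (f g : pinj) : (forall n m, f n m <-> g n m) -> f = g.
Proof.
case: f g => [f ff fi] [g gf gi] /= fg.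
have e : f = g.
  by apply: functional_extensionality => n; apply: functional_extensionality
    => m; apply: propositional_extensionality.
by subst g; congr PInj; apply: proof_irrelevance.
Qed.

Lemma pcomp_functional (f g : pinj) n m m' :
  (exists2 p, g n p & f p m) -> (exists2 p, g n p & f p m') -> m = m'.
Proof.
move=> [p gp fp] [p' gp' fp'].
have e := graph_functional gp gp'; subst p'.
exact: graph_functional fp fp'.
Qed.

Lemma pcomp_injective (f g : pinj) n n' m :
  (exists2 p, g n p & f p m) -> (exists2 p, g n' p & f p m) -> n = n'.
Proof.
move=> [p gp fp] [p' gp' fp'].
have e := graph_injective fp fp'; subst p'.
exact: graph_injective gp gp'.
Qed.

(* First [g], then [f]. *)
Definition pcomp (f g : pinj) : pinj :=
  @PInj (fun n m => exists2 p, g n p & f p m)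
    (@pcomp_functional f g) (@pcomp_injective f g).

Definition pinv (f : pinj) : pinj :=
  @PInj (fun y x => f x y)
    (fun y x x' fx fx' => graph_injective fx fx')
    (fun y y' x fy fy' => graph_functional fy fy').

Definition pzero : pinj :=
  @PInj (fun _ _ => False)
    (fun _ _ _ h => False_ind _ h) (fun _ _ _ h => False_ind _ h).

Notation "f * g" := (pcomp f g) : pinj_scope.
Notation "f ^‡" := (pinv f) (at level 2, left associativity, format "f ^‡")
  : pinj_scope.

Definition R_graph (a b n m : nat) : Prop :=
  (exists j, n = a * j + b) /\ m = (n - b) %/ a.

Lemma R_functional a b n m m' : R_graph a b n m -> R_graph a b n m' -> m = m'.
Proof. by move=> [_ ->] [_ ->]. Qed.

Lemma R_injective a b : b < a ->
  forall n n' m, R_graph a b n m -> R_graph a b n' m -> n = n'.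
Proof.
move=> ltba n n' m [[j ->] ->] [[j' ->]].
have a_gt0 : 0 < a by apply: leq_ltn_trans ltba.
by rewrite !addnK !mulKn // => ->.
Qed.

Definition R (a b : nat) (ltba : b < a) : pinj :=
  @PInj (R_graph a b) (@R_functional a b) (R_injective ltba).
Arguments R a b ltba : clear implicits.

(* Membership in the inverse subsemigroup generated by the [R a b]. *)
Inductive inA : pinj -> Prop :=
| inA_gen a b (ltba : b < a) : inA (R a b ltba)
| inA_comp f g : inA f -> inA g -> inA (f * g)%pinj
| inA_inv f : inA f -> inA (f^‡)%pinj.

Record kpair (k : nat) := KPair {
  kfst : nat;
  ksnd : nat;
  kpairP : ksnd < k ^ kfst
}.
Arguments KPair k kfst ksnd kpairP : clear implicits.

Lemma kmul_subproof k (p q : kpair k) :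
  k ^ kfst q * ksnd p + ksnd q < k ^ (kfst p + kfst q).
Proof.
case: p q => [d c hc] [b a ha] /=.
apply: (@leq_trans (k ^ b * c.+1)); first by rewrite mulnS addnC ltn_add2r.
by rewrite expnD mulnC leq_mul2r hc orbT.
Qed.

Definition kmul k (p q : kpair k) : kpair k :=
  KPair k (kfst p + kfst q) (k ^ kfst q * ksnd p + ksnd q) (kmul_subproof p q).

(* [q] is a [k]-residue of [p]. *)
Definition kresidue k (q p : kpair k) : bool :=
  (kfst q <= kfst p) && (ksnd p %% k ^ kfst q == ksnd q).

Lemma kldiv_subproof k (p q : kpair k) :
  (if kfst q < kfst p then (ksnd p - ksnd q) %/ k ^ kfst q else 0)
    < k ^ (if kfst q < kfst p then kfst p - kfst q else 0).
Proof.
case: ifP => // ltyb; case: p q ltyb => [b a ha] [y x hx] /= ltyb.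
rewrite ltn_divLR ?(leq_ltn_trans _ hx) // -expnD subnK ?(ltnW ltyb) //.
exact: leq_ltn_trans (leq_subr _ _) ha.
Qed.

(* The left quotient [p \ q]; it is meaningful only when [kresidue q p], so the
   [else] branches, giving (0, 0), stand for [kfst q = kfst p]. *)
Definition kldiv k (p q : kpair k) : kpair k :=
  KPair k (if kfst q < kfst p then kfst p - kfst q else 0)
    (if kfst q < kfst p then (ksnd p - ksnd q) %/ k ^ kfst q else 0)
    (kldiv_subproof p q).

(* Main.v *)
(* Reading the pair p = (m, n) as the map R_p := R_{k^m, n}, the product of pairs
   becomes composition, R_{p . q} = R_p R_q, and R_p R_p^‡ = 1.  If q is a residue
   of p then p = (p \ q) . q, so R_p R_q^‡ = R_{p \ q} R_q R_q^‡ = R_{p \ q}; this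
   gives (1), and (2) follows by inversion.  If R_p R_q^‡ is nonzero, some number
   is n modulo k^m for both pairs, and the one with the smaller exponent is
   a residue of the other. *)
Require Import Defs.
From mathcomp Require Import all_boot.

Local Open Scope nat_scope.

Lemma pcompA (f g h : pinj) : (f * (g * h) = f * g * h)%pinj.
Proof.
apply: pinj_ext => n m; split=> /=.
  by move=> [p [q hq gp] fm]; exists q => //; exists p.
by move=> [q hq [p gp fm]]; exists p => //; exists q.
Qed.

Lemma pinvK (f : pinj) : (f^‡^‡ = f)%pinj.
Proof. exact: pinj_ext. Qed.

Lemma pinv_comp (f g : pinj) : ((f * g)^‡ = g^‡ * f^‡)%pinj.
Proof. by apply: pinj_ext => n m; split=> -[p ? ?]; exists p. Qed.

Lemma pcomp0 (f : pinj) : (f * pzero = pzero)%pinj.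
Proof. by apply: pinj_ext => n m; split=> // -[]. Qed.

Lemma p0comp (f : pinj) : (pzero * f = pzero)%pinj.
Proof. by apply: pinj_ext => n m; split=> // -[]. Qed.

(** On the domain both the truncated subtraction and the division are exact, so membership in the
    graph becomes a single affine equation. *)
Lemma RE a b (ltba : b < a) n m : R a b ltba n m <-> n = a * m + b.
Proof.
have a_gt0 : 0 < a by apply: leq_ltn_trans ltba.
split=> [[[j ->] ->] | ->]; first by rewrite addnK mulKn.
by split; [exists m | rewrite addnK mulKn].
Qed.

Definition RK {k} (p : kpair k) : pinj := R (k ^ kfst p) (ksnd p) (kpairP p).

(** The product of pairs is substitution of one affine map into another; [E] is that
    substitution. *)
Lemma RK_mul {k} (p q : kpair k) : RK (kmul p q) = (RK p * RK q)%pinj.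
Proof.
have E m : k ^ kfst q * (k ^ kfst p * m + ksnd p) + ksnd q
    = k ^ (kfst p + kfst q) * m + (k ^ kfst q * ksnd p + ksnd q).
  by rewrite mulnDr mulnA -expnD addnA (addnC (kfst q)).
apply: pinj_ext => n m; split.
  move/RE => ->; exists (k ^ kfst p * m + ksnd p); last exact/RE.
  by apply/RE; rewrite E.
by move=> [j /RE -> /RE ->]; apply/RE; rewrite E.
Qed.

(** [RK p] is onto, so [RK p] after its inverse is the identity. The factor [f] gives the shape that
    expanding a product by [RK_mul] produces. *)
Lemma RK_mulKV {k} (p : kpair k) (f : pinj) : (f * RK p * (RK p)^‡ = f)%pinj.
Proof.
apply: pinj_ext => n m; split.
  by move=> [j nj [i ji im]]; rewrite (graph_functional (nj : RK p j n) ji).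
move=> fnm; exists (k ^ kfst p * n + ksnd p); first exact/RE.
by exists n; first exact/RE.
Qed.

(** Equating maps instead of pairs avoids comparing the bound proofs inside the pairs. *)
Lemma kldivK {k} (p q : kpair k) :
  kresidue q p -> RK p = RK (kmul (kldiv p q) q).
Proof.
move=> /andP[le_qp /eqP res_qp].
suff [E1 E2] : kfst p = kfst (kmul (kldiv p q) q)
    /\ ksnd p = ksnd (kmul (kldiv p q) q).
  by apply: pinj_ext => n m; rewrite /RK !RE -E1 -E2.
rewrite /=; case: ltngtP le_qp => // [lt_qp | eq_qp] _; last first.
  (* With equal exponents the quotient is (0, 0), and [ksnd p] is already reduced, hence equal to
     [ksnd q]. *)
  by split=> //; rewrite muln0 -res_qp eq_qp modn_small // kpairP.
rewrite subnK ?(ltnW lt_qp) //; split=> //.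
have k_gt0 : 0 < k ^ kfst q by apply: leq_ltn_trans (kpairP q).
by rewrite {1 2}(divn_eq (ksnd p) (k ^ kfst q)) res_qp addnK mulnK // mulnC.
Qed.

Lemma RK_residue {k} (p q : kpair k) :
  kresidue q p -> (RK p * (RK q)^‡ = RK (kldiv p q))%pinj.
Proof. by move=> /kldivK ->; rewrite RK_mul RK_mulKV. Qed.

Lemma meet_residue {k} (p q : kpair k) i j : kfst q <= kfst p ->
  k ^ kfst q * j + ksnd q = k ^ kfst p * i + ksnd p -> kresidue q p.
Proof.
move=> le_qp E; rewrite /kresidue le_qp /=.
(* Adding a multiple of [k ^ kfst q] turns [ksnd p] into the common value, whose remainder is read
   off from [q]. *)
rewrite -(modnMDl (k ^ (kfst p - kfst q) * i)) mulnAC -expnD subnK // -E.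
by rewrite mulnC modnMDl modn_small // kpairP.
Qed.

Lemma RK_nonresidue {k} (p q : kpair k) :
  ~~ kresidue q p -> ~~ kresidue p q -> (RK p * (RK q)^‡ = pzero)%pinj.
Proof.
move=> Nqp Npq; apply: pinj_ext => n m; split=> // -[l ql /RE E].
(* The intermediate point [l] lies in both domains, hence has two affine expressions. *)
move: (ql : RK q l n) => /RE; rewrite E => /esym {}E.
case: (leqP (kfst q) (kfst p)) => [le_qp | /ltnW le_pq].
  by rewrite (meet_residue _ _ _ _ le_qp E) in Nqp.
by rewrite (meet_residue _ _ _ _ le_pq (esym E)) in Npq.
Qed.

(** Stated for arbitrary pairs so that it also serves the inverted product of case (2). *)
Lemma RK_quotient_mul {k} (x w v u : kpair k) : kresidue v w ->
  (((RK x)^‡ * RK w) * ((RK v)^‡ * RK u)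
   = (RK x)^‡ * RK (kmul (kldiv w v) u))%pinj.
Proof.
by move=> res; rewrite pcompA -(pcompA (RK x)^‡%pinj) RK_residue // -pcompA RK_mul.
Qed.

Theorem corollary42 (k : nat) (hk : 1 < k) (x w v u X W V U : nat)
    (hX : X < k ^ x) (hW : W < k ^ w) (hV : V < k ^ v) (hU : U < k ^ u) :
  let f := ((R (k ^ x) X hX)^‡ * R (k ^ w) W hW)%pinj in
  let g := ((R (k ^ v) V hV)^‡ * R (k ^ u) U hU)%pinj in
  let xX := KPair k x X hX in
  let wW := KPair k w W hW in
  let vV := KPair k v V hV in
  let uU := KPair k u U hU in
  (inA f /\ inA g) /\
  (kresidue vV wW ->
     let sS := kmul (kldiv wW vV) uU in
     (f * g)%pinj =
     ((R (k ^ x) X hX)^‡ * R (k ^ kfst sS) (ksnd sS) (kpairP sS))%pinj) /\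
  (kresidue wW vV ->
     let tT := kmul (kldiv vV wW) xX in
     (f * g)%pinj =
     ((R (k ^ kfst tT) (ksnd tT) (kpairP tT))^‡ * R (k ^ u) U hU)%pinj) /\
  (~~ kresidue vV wW /\ ~~ kresidue wW vV -> (f * g)%pinj = pzero).
Proof.
move=> f g xX wW vV uU.
have fE : f = ((RK xX)^‡ * RK wW)%pinj by [].
have gE : g = ((RK vV)^‡ * RK uU)%pinj by [].
split; first by split; apply: inA_comp; try apply: inA_inv; apply: inA_gen.
split; first by move=> res sS; rewrite fE gE RK_quotient_mul.
split=> [res tT | [Nvw Nwv]].
  (* The inverse of the composite is the product of case (1) with [x], [u] exchanged and [w], [v]
     exchanged. *)
  rewrite -[LHS]pinvK pinv_comp fE gE !(pinv_comp _ (RK _)) !pinvK.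
  by rewrite RK_quotient_mul // pinv_comp pinvK.
rewrite fE gE pcompA -(pcompA (RK xX)^‡%pinj) RK_nonresidue //.
by rewrite pcomp0 p0comp.
Qed.
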